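(* Let $M$ be a Moufang loop, let $K\ge 1$, and let $A\subseteq M$ be a finite $K$-approximate subloop. If the subloop $H=\langle A\rangle$ generated by $A$ can be generated by at most two elements, then $H$ is a group. Consequently $A$ is a $K$-approximate subgroup of the group $H$, i.e. $A$ is finite, $1\in A$, $A=A^{-1}$ and $|A^3|\le K|A|$.
   Context: A loop is a set with a binary operation having a two-sided identity $1$ such that for all $a,b$ the equations $ax=b$ and $ya=b$ have unique solutions. A Moufang loop is a loop satisfying $(xy)(zx)=(x(yz))x$ for all $x,y,z$. For subsets $X,Y$ of a loop, $XY=\{xy:x\in X,y\in Y\}$. For a finite subset $A$ of a loop, $A^{\langle 3\rangle}:=(AA)A\cup A(AA)$. A finite subset $A$ of a loop is a $K$-approximate subloop if $1\in A$, $A=A^{-1}$ and $|A^{\langle 3\rangle}|\le K|A|$. $\langle A\rangle$ denotes the subloop generated by $A$. *)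

(* Defs.v *)
From HB Require Import structures.
From mathcomp Require Import all_boot all_order all_algebra finmap.
From mathcomp Require Import boolp classical_sets reals.

Set Implicit Arguments.
Unset Strict Implicit.
Unset Printing Implicit Defensive.

Local Open Scope classical_set_scope.
Local Open Scope group_scope.

HB.mixin Record UMagma_isLoop L of UMagma L := {
  loop_ldiv : forall a b : L, exists! x, a * x = b;
  loop_rdiv : forall a b : L, exists! y, y * a = b
}.

#[short(type="loopType")]
HB.structure Definition Loop := {L of UMagma_isLoop L & UMagma L}.

HB.mixin Record Loop_isMoufang L of Loop L := {
  moufang_id : forall x y z : L, (x * y) * (z * x) = (x * (y * z)) * x
}.

#[short(type="moufangLoopType")]
HB.structure Definition MoufangLoop := {L of Loop_isMoufang L & Loop L}.

Section LoopTheory.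
Variable L : loopType.
Implicit Types (a x y : L) (S X : set L).

Lemma loop_mulgI a x y : a * x = a * y -> x = y.
Proof. by move=> e; have [z [_ h]] := loop_ldiv a (a * y); rewrite -(h x e) -(h y). Qed.

Lemma loop_mulIg a x y : x * a = y * a -> x = y.
Proof. by move=> e; have [z [_ h]] := loop_rdiv a (y * a); rewrite -(h x e) -(h y). Qed.

Lemma loop_inv_ex a : exists x, a * x == 1.
Proof. by have [x [h _]] := loop_ldiv a 1; exists x; apply/eqP. Qed.

(* The right inverse. In a Moufang loop it is also a left inverse, see
   [loop_invl]; in any loop, being fixed by the right inverse map or by the
   left inverse map is the same condition on a subset, since these two maps
   are mutually inverse bijections. *)
Definition loop_inv a : L := xchoose (loop_inv_ex a).

Lemma loop_invr a : a * loop_inv a = 1.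
Proof. exact/eqP/(xchooseP (loop_inv_ex a)). Qed.

Definition subloop S : Prop :=
  [/\ S 1,
      forall a b, S a -> S b -> S (a * b),
      forall a b x, S a -> S b -> a * x = b -> S x
    & forall a b y, S a -> S b -> y * a = b -> S y].

Definition subloop_gen X : set L := smallest subloop X.

Definition generated_by_at_most n S : Prop :=
  exists2 X : {fset L}, (#|` X| <= n)%N & S = subloop_gen [set` X].

End LoopTheory.

Lemma loop_invl (M : moufangLoopType) (a : M) : loop_inv a * a = 1.
Proof.
have aV z : a * (loop_inv a * z) = z.
  by apply: (@loop_mulIg _ a); rewrite -moufang_id loop_invr mul1g.
by apply: (@loop_mulgI _ a); rewrite aV mulg1.
Qed.

Definition fset_mul (T : ChoiceMagma.type) (X Y : {fset T}) : {fset T} :=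
  [fset x * y | x in X, y in Y]%fset.

Definition fset_cube (T : ChoiceMagma.type) (X : {fset T}) : {fset T} :=
  (fset_mul (fset_mul X X) X `|` fset_mul X (fset_mul X X))%fset.

Definition approximate_subloop (R : realType) (L : loopType) (K : R)
    (A : {fset L}) : Prop :=
  [/\ 1 \in A,
      A = [fset loop_inv a | a in A]%fset
    & (#|` fset_cube A|%:R <= K * #|` A|%:R)%R].

Definition approximate_subgroup (R : realType) (G : groupType) (K : R)
    (A : {fset G}) : Prop :=
  [/\ 1 \in A,
      A = [fset a^-1 | a in A]%fset
    & (#|` fset_mul (fset_mul A A) A|%:R <= K * #|` A|%:R)%R].

Definition is_group_under (T : Type) (op : T -> T -> T) (S : set T) : Prop :=
  [/\ forall x y, S x -> S y -> S (op x y),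
      forall x y z, S x -> S y -> S z -> op x (op y z) = op (op x y) z
    & exists e, [/\ S e, forall x, S x -> op e x = x /\ op x e = x
        & forall x, S x -> exists y, [/\ S y, op x y = e & op y x = e]]].

(* The library group carried by a subset [S] of a magma that is a group under
   the ambient multiplication. *)
Section GroupOfSet.
Variables (T : ChoiceMagma.type) (S : set T).
Hypothesis grS : is_group_under *%g S.

Record set_group_sort (gr : is_group_under *%g S) : Type :=
  SetGroupElt { set_group_val : T; set_group_valP : set_group_val \in S }.
Local Notation G := (set_group_sort grS).

HB.instance Definition _ := [isSub for @set_group_val grS].
HB.instance Definition _ := [Choice of G by <:].

Let memG (u : G) : S (val u). Proof. exact/set_mem/(valP u). Qed.

Let mulG (u v : G) : G :=
  Sub (val u * val v)
    (mem_set (let: And3 cl _ _ := grS in cl _ _ (memG u) (memG v))).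

Let oneG_ex : exists e : G, `[< forall u, mulG e u = u /\ mulG u e = u >].
Proof.
have [_ _ [e [Se ide _]]] := grS; exists (Sub e (mem_set Se)).
apply/asboolP => u; have [h1 h2] := ide _ (memG u).
by split; apply: val_inj; rewrite !SubK.
Qed.

Let oneG : G := xchoose oneG_ex.

Let oneGP u : mulG oneG u = u /\ mulG u oneG = u.
Proof. by have /asboolP := xchooseP oneG_ex. Qed.

Let invG_ex (u : G) : exists v : G, (mulG v u == oneG) && (mulG u v == oneG).
Proof.
have [_ _ [e [Se ide inve]]] := grS.
have eE : e = val oneG.
  have [h _] := oneGP (Sub e (mem_set Se)).
  by have := congr1 val h; rewrite !SubK => <-; case: (ide _ (memG oneG)).
have [v [Sv uv vu]] := inve _ (memG u); exists (Sub v (mem_set Sv)).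
by apply/andP; split; apply/eqP/val_inj; rewrite !SubK -eE.
Qed.

Let invG (u : G) : G := xchoose (invG_ex u).

Let mulGA : associative mulG.
Proof.
move=> u v w; apply: val_inj; rewrite !SubK.
by have [_ assoc _] := grS; apply: assoc; apply: memG.
Qed.

Let mul1G : left_id oneG mulG. Proof. by move=> u; case: (oneGP u). Qed.
Let mulG1 : right_id oneG mulG. Proof. by move=> u; case: (oneGP u). Qed.
Let mulVG : left_inverse oneG invG mulG.
Proof. by move=> u; have /andP[/eqP] := xchooseP (invG_ex u). Qed.
Let mulGV : right_inverse oneG invG mulG.
Proof. by move=> u; have /andP[_ /eqP] := xchooseP (invG_ex u). Qed.

HB.instance Definition _ := isGroup.Build G mulGA mul1G mulG1 mulVG mulGV.

Definition set_group : groupType := G.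

Lemma set_group_valM (u v : set_group) :
  set_group_val (u * v) = set_group_val u * set_group_val v.
Proof. by []. Qed.

End GroupOfSet.

(* Main.v *)
Require Import Defs.
From mathcomp Require Import all_boot all_order all_algebra finmap.
From mathcomp Require Import boolp classical_sets reals.
From mathcomp Require Import zify.

(** It suffices to know that a Moufang loop is diassociative. The relation
    [a (b c) = (a b) c] turns out to be invariant under all permutations of
    [a, b, c]. Consider words in [x], [y] and their inverses, and suppose that
    all products of total length less than [n] are independent of bracketing.
    If [p] starts and [r] ends with powers of the same generator, the Moufang
    identity shows that [p, q, r] associate, the total length being [n].
    Finally, for a letter [l] and nonempty words [q, r], two of [l], the last
    letter of [q] and the first letter of [r] are powers of the same generator,
    so that after a permutation the previous case applies to [l, q, r]. *)

Local Open Scope group_scope.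

Section Moufang.
Variable M : moufangLoopType.
Implicit Types a b c x y z : M.
Local Notation "x ^-1" := (loop_inv x) : group_scope.

(** * Inverse properties of a Moufang loop *)

Lemma moufang_flex x y : x * (y * x) = (x * y) * x.
Proof. by have := moufang_id x 1 y; rewrite mulg1 mul1g. Qed.

Lemma moufang_mulKV a z : a * (a^-1 * z) = z.
Proof. by apply: (@loop_mulIg _ a); rewrite -moufang_id loop_invr mul1g. Qed.

Lemma moufang_invK a : a^-1^-1 = a.
Proof. by apply: (@loop_mulgI _ a^-1); rewrite loop_invr loop_invl. Qed.

Lemma moufang_mulK a z : a^-1 * (a * z) = z.
Proof. by have := moufang_mulKV a^-1 z; rewrite moufang_invK. Qed.

Lemma moufang_mulgKV a z : (z * a^-1) * a = z.
Proof.
apply: (@loop_mulgI _ a).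
by rewrite moufang_flex -moufang_id loop_invl mulg1.
Qed.

Lemma moufang_mulgK a z : (z * a) * a^-1 = z.
Proof. by have := moufang_mulgKV a^-1 z; rewrite moufang_invK. Qed.

Lemma moufang_invM a b : (a * b)^-1 = b^-1 * a^-1.
Proof.
apply: (@loop_mulIg _ a); rewrite moufang_mulgKV.
by rewrite -{2}(moufang_mulgK b a) moufang_mulK.
Qed.

(** * Permuting the entries of an associating triple *)

Definition associate a b c := a * (b * c) = (a * b) * c.

(** As [b = a^-1 * (a * b)], the left side has the Moufang form [(x * y) * (z * x)] with
    [x = a^-1]. *)
Lemma associate_rotV a b c : associate a b c -> associate b c a^-1.
Proof.
move=> abc; rewrite /associate.
by rewrite -[b in LHS](moufang_mulK a) moufang_id -abc moufang_mulK.
Qed.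

Lemma associate_opp a b c : associate a b c -> associate c^-1 b^-1 a^-1.
Proof. by move=> abc; rewrite /associate -!moufang_invM abc. Qed.

(** Three rotations invert every entry; inverting both sides undoes this and reverses the order. *)
Lemma associate_rev a b c : associate a b c -> associate c b a.
Proof.
move=> /associate_rotV/associate_rotV/associate_rotV/associate_opp.
by rewrite !moufang_invK.
Qed.

Lemma moufang_left a b c : ((a * b) * a) * c = a * (b * (a * c)).
Proof.
have cE : ((a * c)^-1 * a)^-1 = c.
  by rewrite (moufang_invM _ a) moufang_invK moufang_mulK.
(* For [y = b * (a * c)] and [z = (a * c)^-1], the product [y * z] is [b], and [c] is the inverse of
   [z * a]. *)
have := moufang_id a (b * (a * c)) (a * c)^-1; rewrite moufang_mulgK => <-.
by rewrite -{3}cE moufang_mulgK.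
Qed.

Lemma associate_mulr a b c : associate b a c -> associate a (b * a) c.
Proof. by move=> bac; rewrite /associate moufang_flex moufang_left bac. Qed.

Lemma associate_mulrV a b c : associate a b c^-1 -> associate a (b * a) c.
Proof.
move=> /associate_rotV/associate_rev/associate_rotV/associate_rotV.
by rewrite !moufang_invK; apply: associate_mulr.
Qed.

Lemma associate_mulVr a b c : associate a b c -> associate a^-1 (b * a) c.
Proof.
move=> /associate_rev cba; apply: associate_rev.
by rewrite /associate moufang_mulgK cba moufang_mulgK.
Qed.

Lemma associate_mulrr a b c : associate a b c -> associate a (b * a * a) c.
Proof.
by move=> abc; do 2!apply: associate_mulrV; rewrite moufang_invK.
Qed.

(** The middle entry first grows to [((b * a) * a) * a] while [a] turns into [a^-1]. Appending
    [a^-1] three times restores [b], and since each time inverts [c], the odd number leaves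
    [c^-1]. *)
Lemma associate_invlr a b c : associate a b c -> associate a^-1 b c^-1.
Proof.
move=> /associate_mulrr/associate_mulVr.
rewrite -{1}[c]moufang_invK => /associate_mulrV/associate_mulrr.
by rewrite !moufang_mulgK.
Qed.

Lemma associate_inv2 a b c : associate a b c -> associate a b^-1 c.
Proof.
move=> /associate_invlr/associate_rotV/associate_rotV/associate_rotV.
by rewrite !moufang_invK.
Qed.

(** Two rotations leave two entries inverted; [associate_inv2] and one more rotation clear these
    signs. Together with [associate_rev] this gives all permutations. *)
Lemma associate_swap a b c : associate a b c -> associate a c b.
Proof.
move=> /associate_rotV/associate_rotV/associate_inv2.
by move=> /associate_rev/associate_rotV; rewrite !moufang_invK.
Qed.

Lemma associate_rot a b c : associate a b c -> associate b c a.
Proof. by move=> /associate_swap/associate_rev. Qed.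

(** * Words in two generators and their inverses *)

Section Words.
Variables g h : M.

(* The letter [(i, e)] stands for [g] or [h] according to [i], inverted when
   [e] holds. *)
Definition letter_eval (l : bool * bool) :=
  let z := if l.1 then g else h in if l.2 then z^-1 else z.

Definition word_eval (w : seq (bool * bool)) : M :=
  foldr (fun l z => letter_eval l * z) 1 w.
Local Notation ev := word_eval.

Lemma letter_evalV l : letter_eval (l.1, ~~ l.2) = (letter_eval l)^-1.
Proof. by case: l => [i []]; rewrite /letter_eval /= ?moufang_invK. Qed.

Lemma word_eval1 l : ev [:: l] = letter_eval l.
Proof. exact: mulg1. Qed.

Section ShortWords.
Variable n : nat.
Hypothesis ev_short : forall u v, (size u + size v < n)%N ->
  ev u * ev v = ev (u ++ v).

Lemma word_eval_rcons u l : ((size u).+1 < n)%N ->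
  ev (rcons u l) = ev u * letter_eval l.
Proof.
by move=> un; rewrite -cats1 -ev_short ?word_eval1 //= addn1.
Qed.

(** Both bracketings have the form [(x * y) * (z * x)] with [x] the common letter. Moving it outside
    leaves [u], [q], [v], of total length at most [n - 2], where bracketing is irrelevant. *)
Lemma associate_same_ends l u q v : (size u + size q + size v + 2 <= n)%N ->
  associate (ev (l :: u)) (ev q) (ev (rcons v l)).
Proof.
move=> len; rewrite /associate ev_short ?size_rcons; last lia.
rewrite [ev (l :: u) * ev q]ev_short /=; last lia.
rewrite -rcons_cat !word_eval_rcons ?size_cat; try lia.
rewrite !moufang_id !ev_short ?size_cat ?catA //; lia.
Qed.

(* Writing [v l' = ((v l') l') l], the Moufang identity reduces the claim to
   words that end with two equal letters. *)
Lemma associate_inverse_ends l u q v : (size u + size q + size v + 2 <= n)%N ->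
  associate (ev ((l.1, ~~ l.2) :: u)) (ev q) (ev (rcons v l)).
Proof.
move=> len; rewrite /associate /= letter_evalV.
set x := letter_eval l; set t := ev (rcons v l).
have qtE : ev q * t = ev (q ++ rcons v l).
  by rewrite ev_short ?size_rcons //; lia.
(* Once rotated to the front, the letter [l] faces a word that also ends in [l]. *)
have uqt : associate (ev u) (ev q * t) x.
  apply: associate_rot; rewrite qtE -rcons_cat -[x]word_eval1.
  by apply: associate_same_ends; rewrite /= size_cat; lia.
have uq_t : associate (ev u * ev q) t x.
  apply: associate_rot; rewrite ev_short -?[x]word_eval1; last lia.
  by apply: associate_same_ends; rewrite /= size_cat; lia.
have assoc : ev u * (ev q * t) = (ev u * ev q) * t.
  by rewrite qtE !ev_short ?size_cat ?size_rcons ?catA //; lia.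
have xuq : (x^-1 * ev u) * ev q = x^-1 * (ev u * ev q).
  by rewrite -letter_evalV ev_short ?[LHS](ev_short (_ :: u)) //=; lia.
rewrite xuq -[ev q * t](moufang_mulgK x) -[in RHS](moufang_mulgK x t).
by rewrite !moufang_id uqt uq_t assoc.
Qed.

Lemma associate_ends l m u q v : l.1 = m.1 ->
  (size u + size q + size v + 2 <= n)%N ->
  associate (ev (l :: u)) (ev q) (ev (rcons v m)).
Proof.
case: l => i e /= ->; have [->|em] := eqVneq e m.2.
  by rewrite -surjective_pairing; apply: associate_same_ends.
have -> : e = ~~ m.2 by case: e m.2 em => [] [].
exact: associate_inverse_ends.
Qed.

End ShortWords.

Lemma word_eval_cat u v : ev (u ++ v) = ev u * ev v.
Proof.
have [n] := ubnP (size u + size v); elim: n u v => // n IHn u v len.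
have ev_short p q : (size p + size q < n)%N -> ev p * ev q = ev (p ++ q).
  by move=> lt_pq; rewrite IHn.
case: u len => [|l u] /= len; first by rewrite mul1g.
case/lastP: u len => [|u m] len; first by rewrite mulg1.
case: v len => [|k v] /= len; first by rewrite cats0 mulg1.
rewrite size_rcons in len.
rewrite -ev_short ?size_rcons /=; last lia.
suff: associate (ev [:: l]) (ev (rcons u m)) (ev (k :: v)).
  by rewrite /associate word_eval1.
have [lm|lm] := eqVneq l.1 m.1.
  by apply: associate_swap; apply: (associate_ends n ev_short) => //=; lia.
have [kl|kl] := eqVneq k.1 l.1.
  apply: associate_rev; apply: (associate_ends n ev_short _ _ _ _ [::]) => //=.
  by rewrite size_rcons; lia.
(* There are only two generators, and that of [l] differs from those of both [m] and [k]. *)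
have km : k.1 = m.1 by case: l.1 m.1 k.1 lm kl => [] [] [].
by apply: associate_rot; apply: (associate_ends n ev_short) => //=; lia.
Qed.

Lemma word_eval_inv u : exists v, (ev u)^-1 = ev v.
Proof.
elim: u => [|l u [v uV]].
  by exists [::]; rewrite -[LHS]mul1g loop_invr.
exists (rcons v (l.1, ~~ l.2)).
by rewrite -cats1 word_eval_cat word_eval1 letter_evalV /= moufang_invM uV.
Qed.

Lemma subloop_range_word_eval : subloop (range ev).
Proof.
split=> [|_ _ [u _ <-] [v _ <-]|_ _ x [u _ <-] [v _ <-] uxv
         |_ _ y [u _ <-] [v _ <-] yuv]; first by exists [::].
- by exists (u ++ v); rewrite ?word_eval_cat.
- have [w uV] := word_eval_inv u; exists (w ++ v) => //.
  by rewrite word_eval_cat -uV -uxv moufang_mulK.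
- have [w uV] := word_eval_inv u; exists (v ++ w) => //.
  by rewrite word_eval_cat -uV -yuv moufang_mulgK.
Qed.

End Words.

(** * Diassociativity *)

Lemma subloop_subloop_gen (X : set M) : subloop (subloop_gen X).
Proof.
split=> [S [[]] //|a b aX bX S SX|a b x aX bX abx S SX|a b y aX bX yab S SX].
- by case: (SX) => -[_ SM _ _] _; apply: SM; [apply: aX|apply: bX].
- by case: (SX) => -[_ _ SD _] _; apply: SD abx; [apply: aX|apply: bX].
- by case: (SX) => -[_ _ _ SD] _; apply: SD yab; [apply: aX|apply: bX].
Qed.

Lemma diassociative (H : set M) :
  generated_by_at_most 2 H -> is_group_under *%g H.
Proof.
case=> X X2 ->; have [H1 HM HD _] := subloop_subloop_gen [set` X].
(* Missing generators are filled in by [1] or by repetition. *)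
have [g [h Xgh]] : exists g h, forall z, z \in X -> z = g \/ z = h.
  have XmemE z : (z \in X) = (z \in enum_fset X) by [].
  case XE: (enum_fset X) X2 => [|g [|h [|]]] // _.
  - by exists 1, 1 => z; rewrite XmemE XE.
  - by exists g, g => z; rewrite XmemE XE inE => /eqP; left.
  - by exists g, h => z; rewrite XmemE XE !inE => /orP[] /eqP; [left|right].
split=> //; first move=> a b c Ha Hb Hc.
(* The word values form a subloop containing the generators, so associativity in [H] comes from that
   of concatenation. *)
- have sub z : subloop_gen [set` X] z -> range (word_eval g h) z.
    apply; split; first exact: subloop_range_word_eval.
    move=> z' /Xgh[]->; [exists [:: (true, false)]|exists [:: (false, false)]];
    by rewrite // word_eval1.
  have [[u _ <-] [v _ <-] [w _ <-]] := And3 (sub a Ha) (sub b Hb) (sub c Hc).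
  by rewrite -!word_eval_cat catA.
- exists 1; split=> // [a _|a Ha]; first by rewrite mul1g mulg1.
  exists a^-1; rewrite loop_invr loop_invl; split=> //.
  exact: HD Ha H1 (loop_invr a).
Qed.

End Moufang.

(** * Transport of [A] to the group *)

(** The unit of [set_group] is chosen only by its property, so its value is found by cancelling in
    [e * e = e]. *)
Lemma set_group_val1 (L : loopType) (S : set L) (gr : is_group_under *%g S) :
  set_group_val (1 : set_group gr) = 1.
Proof.
apply: (@loop_mulgI _ (set_group_val (1 : set_group gr))).
by rewrite -set_group_valM !mulg1.
Qed.

Lemma set_group_valV (L : loopType) (S : set L) (gr : is_group_under *%g S)
  (u : set_group gr) : set_group_val u^-1 = loop_inv (set_group_val u).
Proof.
apply: (@loop_mulgI _ (set_group_val u)).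
by rewrite -set_group_valM mulgV loop_invr set_group_val1.
Qed.

Theorem corollary4p5 (R : realType) (M : moufangLoopType) (K : R)
    (A : {fset M}) :
  (1 <= K)%R ->
  approximate_subloop K A ->
  generated_by_at_most 2 (subloop_gen [set` A]%classic) ->
  exists (grH : is_group_under *%g (subloop_gen [set` A]%classic))
         (B : {fset set_group grH}),
    A = [fset set_group_val b | b in B]%fset /\ approximate_subgroup K B.
Proof.
move=> _ [A1 AV AK] /diassociative grH; exists grH.
have invA a : a \in A -> loop_inv a \in A.
  by move=> aA; rewrite AV in_imfset.
pose B : {fset set_group grH} :=
  [fset insubd (1 : set_group grH) a | a in A]%fset.
have valB b : (b \in B) = (set_group_val b \in A).
  apply/imfsetP/idP => [[a /= aA ->]|bA].
    (* Where [insubd] returns its default [1], the claim becomes [1 \in A]. *)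
    rewrite /= -[set_group_val _]/(val _) val_insubd; case: ifP => // _.
    by rewrite /= set_group_val1.
  by exists (set_group_val b); rewrite ?valKd.
have valAE : A = [fset set_group_val b | b in B]%fset.
  apply/fsetP => a; apply/idP/imfsetP => [aA|[b /= bB ->]].
  2: by rewrite -valB.
  have aH : a \in subloop_gen [set` A]%classic.
    by apply: mem_set => S [_]; apply.
  by exists (SetGroupElt grH aH); rewrite //= valB.
have card_val (C : {fset set_group grH}) :
    #|` [fset set_group_val c | c in C]%fset| = #|` C|.
  by rewrite card_imfset //; apply: val_inj.
exists B; split=> //; split.
- by rewrite valB set_group_val1.
- apply/fsetP => b; apply/idP/imfsetP => [bB|[c /= cB ->]].
    by exists b^-1; rewrite ?invgK //= valB set_group_valV invA -?valB.
  by rewrite valB set_group_valV invA -?valB.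
(* The injection into [M] maps [(BB)B] into [(AA)A], a part of [fset_cube A]. *)
- have -> : #|` B| = #|` A| by rewrite -card_val -valAE.
  apply: (Order.POrderTheory.le_trans _ AK); rewrite Num.Theory.ler_nat.
  rewrite -card_val.
  apply/fsubset_leq_card/fsubsetP => _ /imfsetP[_ /imfset2P[_
    /imfset2P[b1 /= B1 [b2 /= B2 ->]] [b3 /= B3 ->]] ->].
  rewrite inE !set_group_valM; apply/orP; left.
  by rewrite !in_imfset2 //= -valB.
Qed.
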